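(* Let $k\ge 1$. If $G$ is a $k$-vertex-critical $(P_3+P_1)$-free graph, then $\alpha(G)\le 2$. Moreover, the maximum number of vertices in a $k$-vertex-critical $(P_3+P_1)$-free graph is $2k-1$.
   Context: All graphs are finite, simple and undirected. $\alpha(G)$ denotes the independence number of $G$ (the order of a largest independent set). A graph $G$ is $H$-free if it does not contain $H$ as an induced subgraph. A graph $G$ is $k$-vertex-critical if $\chi(G)=k$ but $\chi(G-v)<k$ for every vertex $v$ of $G$, where $\chi$ is the chromatic number (the minimum number of colors required to color the vertices so that adjacent vertices get different colors) and $G-v$ is obtained from $G$ by deleting $v$ and its incident edges. $P_t$ is the path on $t$ vertices, and $P_3+P_1$ is the disjoint union of a path on three vertices and an isolated vertex.
   Formalization: The claim that the maximum number of vertices equals 2k-1 is false for k=2 (the only 2-vertex-critical graph is K_2, with 2 vertices); the upper bound 2k-1 is proved for all k≥1, and its attainment for all k≥1 except k=2. *)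

(* Defs.v *)
From mathcomp Require Import all_boot.

Set Implicit Arguments.
Unset Strict Implicit.
Unset Printing Implicit Defensive.

Record sgraph := SGraph {
  svertex :> finType;
  sedge : rel svertex;
  sedge_sym : symmetric sedge;
  sedge_irrefl : irreflexive sedge
}.

Arguments sedge {G} x y : rename.

Section Induced.
Variables (G : sgraph) (S : {set G}).

Definition induced_rel : rel {x : G | x \in S} :=
  fun x y => sedge (val x) (val y).

Lemma induced_sym : symmetric induced_rel.
Proof. by move=> x y; rewrite /induced_rel sedge_sym. Qed.

Lemma induced_irrefl : irreflexive induced_rel.
Proof. by move=> x; rewrite /induced_rel sedge_irrefl. Qed.

Definition induced : sgraph := SGraph induced_sym induced_irrefl.
End Induced.

Definition del_vertex (G : sgraph) (v : G) : sgraph := induced [set~ v].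

Section Path.
Variable t : nat.

Definition path_rel : rel 'I_t :=
  fun i j => (i.+1 == j :> nat) || (j.+1 == i :> nat).

Lemma path_sym : symmetric path_rel.
Proof. by move=> i j; rewrite /path_rel orbC. Qed.

Lemma path_irrefl : irreflexive path_rel.
Proof. by move=> i; rewrite /path_rel orbb gtn_eqF. Qed.

Definition path_graph : sgraph := SGraph path_sym path_irrefl.
End Path.

Section DisjointUnion.
Variables G H : sgraph.

Definition disjoint_union_rel : rel (G + H)%type := fun x y =>
  match x, y with
  | inl a, inl b => sedge a b
  | inr a, inr b => sedge a b
  | _, _ => false
  end.

Lemma disjoint_union_sym : symmetric disjoint_union_rel.
Proof. by move=> [x|x] [y|y] //=; rewrite sedge_sym. Qed.

Lemma disjoint_union_irrefl : irreflexive disjoint_union_rel.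
Proof. by move=> [x|x] /=; rewrite sedge_irrefl. Qed.

Definition disjoint_union : sgraph :=
  SGraph disjoint_union_sym disjoint_union_irrefl.
End DisjointUnion.

Definition isomorphic (G H : sgraph) : Prop :=
  exists2 f : G -> H, bijective f & forall x y, sedge (f x) (f y) = sedge x y.

Definition free_of (H G : sgraph) : Prop :=
  ~ exists S : {set G}, isomorphic H (induced S).

Definition independent (G : sgraph) (S : {set G}) : bool :=
  [forall x in S, forall y in S, ~~ sedge x y].

Definition alpha (G : sgraph) : nat := \max_(S : {set G} | independent S) #|S|.

Definition colorable (G : sgraph) (k : nat) : bool :=
  [exists c : {ffun G -> 'I_k}, forall x, forall y, sedge x y ==> (c x != c y)].

Lemma colorable_order (G : sgraph) : colorable G #|G|.
Proof.
apply/existsP; exists [ffun x => enum_rank x].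
apply/forallP => x; apply/forallP => y; apply/implyP => xy.
rewrite !ffunE (inj_eq enum_rank_inj).
by apply: contraTneq xy => ->; rewrite sedge_irrefl.
Qed.

Definition chi (G : sgraph) : nat :=
  ex_minn (ex_intro (colorable G) #|G| (colorable_order G)).

Definition vertex_critical (k : nat) (G : sgraph) : Prop :=
  chi G = k /\ forall v : G, chi (del_vertex v) < k.

Definition P3_P1 : sgraph := disjoint_union (path_graph 3) (path_graph 1).

(* Main.v *)
Require Import Defs.
From mathcomp Require Import all_boot.
From mathcomp Require Import zify.

Set Implicit Arguments.
Unset Strict Implicit.
Unset Printing Implicit Defensive.

(** The heart of the matter is that criticality is incompatible with three
    pairwise nonadjacent vertices [s], [t], [r].  By symmetry let [s] have at
    most as many neighbours as [t], and let [P] be the set of neighbours of [t]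
    that are not neighbours of [s].  Forbidding P3+P1 makes [t |: P] a clique
    ([private_clique]) all of whose vertices are adjacent to every common
    neighbour of [s] and [t] ([private_common_adjacent]).  By criticality,
    [G - s] has a colouring with [k - 1] colours.  It puts [#|P| + 1] different
    colours on [t |: P], none of which occurs on a common neighbour of [s] and
    [t]; since [s] has at most [#|P|] other neighbours, one of these colours
    does not occur around [s] at all.  Giving it to [s] colours [G] with
    [k - 1] colours, a contradiction ([critical_alpha_le2]).

    The bound on the order then follows by counting: each of the [k - 1] colour
    classes of [G - v] is independent, so has at most two vertices, and
    [#|G| - 1 <= 2 * (k - 1)].

    The bound is attained by the complement of the odd cycle on [2 * k - 1]
    vertices.  For [k <> 2] this cycle has no triangle, so its complement has
    independence number at most two; this alone rules out P3+P1, which contains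
    three independent vertices, and by the same count forces [k] colours.
    Deleting a vertex from the cycle leaves a path with an even number of
    vertices, whose perfect matching is a colouring with [k - 1] colours. *)

(** * Colourings by natural numbers *)

(** Colours are plain natural numbers and the colouring is defined on all of
    [G], so that a colouring of an induced subgraph can be modified at a vertex
    outside it without any change of type. *)
Definition coloring (G : sgraph) (A : {set G}) (j : nat) (c : G -> nat) :=
  {in A, forall x, c x < j} /\ {in A &, forall x y, sedge x y -> c x != c y}.

Lemma colorableP (G : sgraph) j :
  colorable G j <-> exists c, coloring [set: G] j c.
Proof.
split=> [/existsP[c /forallP cP]|[c [cj cP]]].
  exists (fun x => val (c x)); split=> [x _|x y _ _ xy]; first exact: ltn_ord.
  by have /forallP/(_ y)/implyP/(_ xy) := cP x.
apply/existsP; exists [ffun x => Ordinal (cj x (in_setT x))].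
apply/forallP=> x; apply/forallP=> y; apply/implyP=> xy.
by rewrite !ffunE -val_eqE /=; apply: cP; rewrite ?in_setT.
Qed.

Lemma colorable_inducedP (G : sgraph) (A : {set G}) j :
  colorable (induced A) j <-> exists c, coloring A j c.
Proof.
split=> [/colorableP[c [cj cP]]|[c [cj cP]]].
  exists (fun x => if insub x is Some u then c u else 0).
  split=> [x xA|x y xA yA xy]; first by rewrite insubT cj ?in_setT.
  by rewrite !insubT; apply: cP; rewrite ?in_setT.
apply/colorableP; exists (fun u => c (val u)).
split=> [u _|u w _ _ uw]; first exact: cj (valP u).
exact: cP (valP u) (valP w) uw.
Qed.

Lemma colorable_leq (G : sgraph) i j :
  i <= j -> colorable G i -> colorable G j.
Proof.
move=> ij /colorableP[c [ci cP]]; apply/colorableP; exists c.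
by split=> // x xA; apply: leq_trans (ci x xA) ij.
Qed.

Lemma chi_leqE (G : sgraph) j : (chi G <= j) = colorable G j.
Proof.
rewrite /chi; case: ex_minnP => m Gm minm.
by apply/idP/idP => [mj|]; [apply: colorable_leq mj Gm | apply: minm].
Qed.

(** * Independent sets and forbidden subgraphs *)

Lemma alpha_le2P (G : sgraph) :
  reflect (forall a b c : G, uniq [:: a; b; c] ->
             [|| sedge a b, sedge a c | sedge b c])
          (alpha G <= 2).
Proof.
rewrite /alpha; apply: (iffP (bigmax_leqP _ _ _)) =>
  [leS a b c abc | tri S indS].
  apply: contraT; rewrite !negb_or => /and3P[ab ac bc].
  suff /leS : independent [set:: [:: a; b; c]].
    by rewrite cardsE (card_uniqP abc).
  apply/forall_inP=> x; rewrite inE !in_cons => xS.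
  apply/forall_inP=> y; rewrite inE !in_cons => yS.
  move: xS yS; rewrite !in_nil !orbF.
  move=> /or3P[]/eqP-> /or3P[]/eqP->;
    by rewrite ?sedge_irrefl // 1?sedge_sym // 1?sedge_sym.
rewrite leqNgt; apply/negP => /card_gt2P[a [b [c [[aS bS cS] [ab bc ca]]]]].
have nadj x y : x \in S -> y \in S -> sedge x y = false.
  move=> xS yS; apply/negbTE.
  by move/forall_inP/(_ x xS)/forall_inP: indS; apply.
have := tri a b c; rewrite /= !inE negb_or ab bc eq_sym ca !nadj //.
by move/(_ isT).
Qed.

(** The colour classes are independent sets. *)
Lemma coloring_card_leq (G : sgraph) (A : {set G}) j c :
  coloring A j c -> #|A| <= j * alpha G.
Proof.
move=> [cj cP].
have -> : #|A| = \sum_(i < j) #|[set x in A | c x == i]|.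
  rewrite -sum1_card; under [RHS]eq_bigr do rewrite -sum1dep_card big_mkcondr.
  rewrite exchange_big; apply: eq_bigr => x xA.
  rewrite (bigD1 (Ordinal (cj x xA))) //= eqxx big1 // => i.
  by rewrite -val_eqE /= eq_sym => /negbTE->.
rewrite -[j in j * _]card_ord -sum_nat_const; apply: leq_sum => i _.
apply: (bigmax_sup [set x in A | c x == i]) => //.
apply/forall_inP=> x; rewrite inE => /andP[xA /eqP cx].
apply/forall_inP=> y; rewrite inE => /andP[yA /eqP cy].
by apply/negP=> /(cP x y xA yA); rewrite cx cy eqxx.
Qed.

Lemma embedding_not_free (H G : sgraph) (f : H -> G) :
  injective f -> (forall x y, sedge (f x) (f y) = sedge x y) ->
  ~ free_of H G.
Proof.
move=> injf fE; apply; exists (f @: [set: H]).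
pose g x : induced (f @: [set: H]) := exist _ (f x) (imset_f f (in_setT x)).
exists g => //; apply: inj_card_bij => [x y /(congr1 val)/injf //|].
by rewrite card_sig card_imset // cardsT.
Qed.

Lemma P3_P1_free_no_pattern (G : sgraph) (a b c d : G) :
  free_of P3_P1 G -> a != c -> sedge a b -> sedge b c -> ~~ sedge a c ->
  ~~ sedge d a -> ~~ sedge d b -> ~~ sedge d c -> False.
Proof.
move=> freeG ac ab bc Nac Nda Ndb Ndc.
pose f (x : P3_P1) : G :=
  match x with inl i => nth a [:: a; b; c] i | inr _ => d end.
have ba : sedge b a by rewrite sedge_sym.
have cb : sedge c b by rewrite sedge_sym.
have neq x y : sedge x y -> x <> y by move=> xy e; rewrite e sedge_irrefl in xy.
apply: (@embedding_not_free _ _ f) freeG => /=.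
  move=> [[[|[|[|?]]] ?]|[[|?] ?]] [[[|[|[|?]]] ?]|[[|?] ?]] //= e;
    (try by congr (_ _); apply: val_inj); exfalso;
    by [apply: neq e | rewrite e eqxx in ac | rewrite -e eqxx in ac
       | rewrite -?e ?bc ?ba ?ab ?cb in Nda Ndb Ndc
       | rewrite ?e ?bc ?ba ?ab ?cb in Nda Ndb Ndc].
move: Nac Nda Ndb Ndc => /negbTE Nac /negbTE Nda /negbTE Ndb /negbTE Ndc.
by move=> [[[|[|[|?]]] ?]|[[|?] ?]] [[[|[|[|?]]] ?]|[[|?] ?]] //=;
  rewrite ?sedge_irrefl //= /path_rel //= 1?sedge_sym.
Qed.

(** The two ends of the P3 and the isolated vertex are independent. *)
Lemma alpha_le2_P3_P1_free (G : sgraph) : alpha G <= 2 -> free_of P3_P1 G.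
Proof.
move=> /alpha_le2P tri [S [f /bij_inj injf fE]].
pose a : P3_P1 := inl (@ord0 2).
pose c : P3_P1 := inl (@ord_max 2).
pose d : P3_P1 := inr (@ord0 0).
have := tri (val (f a)) (val (f c)) (val (f d)).
have E x y : sedge (val (f x)) (val (f y)) = sedge x y := fE x y.
rewrite !E /= !inE !(inj_eq val_inj) !(inj_eq injf) => /(_ isT).
by [].
Qed.

(** * The independence number of a critical graph *)

Section PrivateNeighbours.
Variables (G : sgraph) (s t : G).
Hypotheses (freeG : free_of P3_P1 G) (Nst : ~~ sedge s t).

(** Two nonadjacent vertices of the set would form a P3 with [t] in the middle,
    and [s] would be isolated from it. *)
Lemma private_clique x y :
    x != y -> x \in t |: [set z | sedge t z && ~~ sedge s z] ->
    y \in t |: [set z | sedge t z && ~~ sedge s z] ->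
  sedge x y.
Proof.
rewrite !inE => xy /predU1P[xt|/andP[tx sx]] /predU1P[yt|/andP[ty sy]].
- by rewrite xt yt eqxx in xy.
- by rewrite xt.
- by rewrite yt sedge_sym.
apply: contraT => Nxy; exfalso.
by apply: (P3_P1_free_no_pattern (a := x) (b := t) (c := y) (d := s));
  rewrite // sedge_sym.
Qed.

(** If [v] is a private neighbour of [t] and [u] a common neighbour, then [r]
    is adjacent to [u], because of the path [s u t], and not to [v], because of
    the path [r v t] and the vertex [s].  Hence [v] sees the path [s u r], and
    its only possible neighbour there is [u]. *)
Lemma private_common_adjacent r u v :
    s != t -> r != s -> r != t -> ~~ sedge r s -> ~~ sedge r t ->
    sedge s u -> sedge t u -> v \in t |: [set z | sedge t z && ~~ sedge s z] ->
  sedge v u.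
Proof.
move=> st rs rt Nrs Nrt su tu; rewrite !inE => /predU1P[->//|/andP[tv Nsv]].
have ru : sedge r u.
  apply: contraT => Nru; exfalso.
  by apply: (P3_P1_free_no_pattern (a := s) (b := u) (c := t) (d := r));
    rewrite // sedge_sym.
have Nrv : ~~ sedge r v.
  apply/negP => rv.
  by apply: (P3_P1_free_no_pattern (a := r) (b := v) (c := t) (d := s));
    rewrite // sedge_sym.
apply: contraT => Nvu; exfalso.
by apply: (P3_P1_free_no_pattern (a := s) (b := u) (c := r) (d := v));
  rewrite // 1?eq_sym // sedge_sym.
Qed.

End PrivateNeighbours.

Lemma critical_del_coloring k (G : sgraph) (v : G) :
  vertex_critical k G -> exists c, coloring [set~ v] k.-1 c.
Proof.
move=> [_ /(_ v) ltk]; apply/colorable_inducedP.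
by rewrite -chi_leqE -ltnS (ltn_predK ltk).
Qed.

(** Giving [s] the colour of [y] would colour the whole of [G] with [k - 1]
    colours. *)
Lemma critical_no_free_color k (G : sgraph) (s : G) c y :
    vertex_critical k G -> coloring [set~ s] k.-1 c -> y != s ->
    (forall x, sedge s x -> c x != c y) ->
  False.
Proof.
move=> [chiG critG] [cj cP] ys freey.
suff : chi G <= k.-1 by rewrite chiG; have := critG s; lia.
rewrite chi_leqE; apply/colorableP.
exists (fun x => if x == s then c y else c x); split=> [x _|x z _ _ xz].
  by case: eqP => [|/eqP] xs; apply: cj; rewrite !inE.
have [xs|xs] := eqVneq x s; have [zs|zs] := eqVneq z s.
- by rewrite xs zs sedge_irrefl in xz.
- by rewrite eq_sym freey // -xs.
- by rewrite freey // -zs sedge_sym.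
- by apply: cP; rewrite ?inE.
Qed.

Lemma critical_alpha_le2 k (G : sgraph) :
  vertex_critical k G -> free_of P3_P1 G -> alpha G <= 2.
Proof.
move=> critG freeG; apply/alpha_le2P => s t r.
rewrite /= !inE negb_or andbT => /andP[/andP[st sr] tr].
apply: contraT; rewrite !negb_or => /and3P[Nst Nsr Ntr]; exfalso.
wlog le_st : s t st sr tr Nst Nsr Ntr /
    #|[set x | sedge s x]| <= #|[set x | sedge t x]|.
  move=> W; have [|/ltnW] := leqP #|[set x | sedge s x]| #|[set x | sedge t x]|.
    exact: W.
  by apply: W; rewrite // 1?eq_sym // sedge_sym.
have [c cG] := critical_del_coloring s critG; have [_ cP] := cG.
pose P := [set x | sedge t x && ~~ sedge s x].
pose Q := [set x | sedge s x && ~~ sedge t x].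
have leQP : #|Q| <= #|P|.
  have -> : P = [set x | sedge t x] :\: [set x | sedge s x].
    by apply/setP=> x; rewrite !inE andbC.
  have -> : Q = [set x | sedge s x] :\: [set x | sedge t x].
    by apply/setP=> x; rewrite !inE andbC.
  rewrite -(leq_add2l #|[set x | sedge s x] :&: [set x | sedge t x]|).
  by rewrite cardsID setIC cardsID.
have Ns x : x \in t |: P -> x != s.
  rewrite !inE => /predU1P[->|/andP[tx _]]; first by rewrite eq_sym.
  by apply: contraTneq tx => ->; rewrite sedge_sym.
have NPs : {subset t |: P <= [set~ s]} by move=> x /Ns xs; rewrite !inE.
(* The clique carries more colours than there are vertices in [Q]. *)
have /allPn[_ /mapP[y yP ->] yQ] : ~~ all [in image c Q] (image c (t |: P)).
  apply/negP=> /allP /uniq_leq_size.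
  rewrite !size_map -!cardE cardsU1 inE sedge_irrefl add1n => le.
  suff /le : uniq (image c (t |: P)) by rewrite leqNgt ltnS leQP.
  rewrite map_inj_in_uniq ?enum_uniq // => x z; rewrite !mem_enum => xP zP cxz.
  apply/eqP/contraT => xz.
  have := private_clique freeG Nst xz xP zP.
  by move/(cP x z (NPs x xP) (NPs z zP)); rewrite cxz eqxx.
rewrite mem_enum in yP.
apply: (critical_no_free_color critG cG (Ns y yP)) => x sx.
have xs : x \in [set~ s].
  by rewrite !inE; apply: contraTneq sx => ->; rewrite sedge_irrefl.
have [tx|Ntx] := boolP (sedge t x); last first.
  apply: contraNneq yQ => <-; apply: image_f.
  by rewrite inE sx.
apply: cP => //; first exact: NPs.
rewrite sedge_sym.
by apply: (private_common_adjacent freeG Nst (r := r));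
  rewrite // 1?eq_sym // sedge_sym.
Qed.

(** Count the [k - 1] colour classes, of size at most two, of [G - v]. *)
Lemma critical_card_leq k (G : sgraph) :
  0 < k -> vertex_critical k G -> free_of P3_P1 G -> #|G| <= 2 * k - 1.
Proof.
move=> k0 critG freeG; have le2 := critical_alpha_le2 critG freeG.
have [|n0] := posnP #|G|; first by move->.
have /card_gt0P[v _] := n0.
have [c /coloring_card_leq] := critical_del_coloring v critG.
by rewrite cardsC1; have := leq_mul (leqnn k.-1) le2; lia.
Qed.

(** * Complements of odd cycles *)

Section CycleComplement.
Variable n : nat.

Definition cycle_step (i j : nat) :=
  (i.+1 == j) || (i == n.-1) && (j == 0).

Definition cycle_compl_rel : rel 'I_n :=
  fun i j => [&& i != j, ~~ cycle_step i j & ~~ cycle_step j i].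

Lemma cycle_compl_sym : symmetric cycle_compl_rel.
Proof.
by move=> i j; rewrite /cycle_compl_rel eq_sym; congr (_ && _); rewrite andbC.
Qed.

Lemma cycle_compl_irrefl : irreflexive cycle_compl_rel.
Proof. by move=> i; rewrite /cycle_compl_rel eqxx. Qed.

Definition cycle_compl : sgraph := SGraph cycle_compl_sym cycle_compl_irrefl.

End CycleComplement.

(** Three independent vertices would form a triangle of the cycle, which only
    happens at length three. *)
Lemma cycle_compl_alpha n : n != 3 -> alpha (cycle_compl n) <= 2.
Proof.
move=> n3; apply/alpha_le2P => -[a an] [b bn] [c cn] /=.
rewrite !inE /cycle_compl_rel /cycle_step -!val_eqE /=.
lia.
Qed.

Lemma cycle_compl_coloring m :
  coloring [set: cycle_compl m.*2.+1] m.+1 (fun x => (x : 'I_m.*2.+1)./2).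
Proof.
split=> [[x xn] _|[x xn] [y yn] _ _] /=; first by lia.
by rewrite /cycle_compl_rel /cycle_step -!val_eqE /=; lia.
Qed.

(** Walking once around the cycle from the deleted vertex, the other vertices
    are paired off in the order in which they are met. *)
Lemma cycle_compl_del_coloring m (v : cycle_compl m.*2.+1) :
  exists c, coloring [set~ v] m c.
Proof.
case: v => v vn.
pose walk x := if v < x then x - v.+1 else x + m.*2 - v.
exists (fun x : 'I_m.*2.+1 => (walk x)./2).
split=> [[x xn]|[x xn] [y yn]]; rewrite !inE -!val_eqE /= /walk.
  by case: (ltnP v x); lia.
rewrite /cycle_compl_rel /cycle_step -[Ordinal xn == _]val_eqE /=.
by case: (ltnP v x); case: (ltnP v y); lia.
Qed.

Lemma cycle_compl_critical (m : nat) :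
  m != 1 -> vertex_critical m.+1 (cycle_compl m.*2.+1).
Proof.
move=> m1; split.
  apply/eqP; rewrite eqn_leq chi_leqE; apply/andP; split.
    by apply/colorableP; eexists; apply: cycle_compl_coloring.
  rewrite ltnNge chi_leqE; apply/negP => /colorableP[c /coloring_card_leq].
  have /cycle_compl_alpha le2 : m.*2.+1 != 3 by lia.
  by rewrite cardsT card_ord; have := leq_mul (leqnn m) le2; lia.
move=> v; rewrite ltnS chi_leqE; apply/colorable_inducedP.
exact: cycle_compl_del_coloring.
Qed.

(* The bound 2k - 1 holds for every k >= 1 but is not attained for k = 2: the
   only 2-vertex-critical graph is K_2. *)
Theorem theorem3p1 (k : nat) (hk : 1 <= k) :
  (forall G : sgraph,
      vertex_critical k G -> free_of P3_P1 G -> alpha G <= 2) /\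
  (forall G : sgraph,
      vertex_critical k G -> free_of P3_P1 G -> #|G| <= 2 * k - 1) /\
  (k <> 2 ->
    exists G : sgraph,
      [/\ vertex_critical k G, free_of P3_P1 G & #|G| = 2 * k - 1]).
Proof.
split; first exact: critical_alpha_le2.
split; first by move=> G; apply: critical_card_leq.
case: k hk => // m _ m1; exists (cycle_compl m.*2.+1); split.
- by apply: cycle_compl_critical; lia.
- by apply/alpha_le2_P3_P1_free/cycle_compl_alpha; lia.
- by rewrite card_ord; lia.
Qed.
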